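(* Let $k\in\mathbb{R}$, let $(X,d)$ be a complete $\mathrm{CAT}(k)$ space and $P$ a bounded subset of $X$ of diameter less than $D_k/4$. Let $u:P\to\mathbb{R}$ be a non-negative bounded function, not identically $0$. Suppose that $x\in X$ and $P\subset\overline{B(x,r)}$ where $r<D_k/2$. Then the barycenter $q_u$ of $P$ relative to $u$ lies in $\overline{B(x,r)}$. In particular, if $r=r_1$ is the circumradius of $P$ and $x=q_1$ is the circumcenter of $P$, then $q_u\in\overline{B(x,r)}$.
   Context: For $k>0$ put $D_k=\pi/\sqrt{k}$; for $k\le 0$ put $D_k=\infty$. $M_k^2$ is the model surface of constant curvature $k$ (rescaled sphere, Euclidean plane, or rescaled hyperbolic plane). A geodesic metric space $X$ is $\mathrm{CAT}(k)$ if every geodesic triangle in $X$ of perimeter less than $2D_k$ has a comparison triangle in $M_k^2$ (same side lengths) such that distances between points of the triangle are at most the distances between the corresponding comparison points. $\overline{B(x,r)}$ is the closed ball of center $x$ and radius $r$. For $u:P\to\mathbb{R}$ bounded, non-negative and not identically $0$, put $r_u=\inf_{x\in X}\sup\{u(p)d(x,p)\mid p\in P\}$ (the baryradius); the barycenter of $P$ relative to $u$ is the point $q_u\in X$ (which exists and is unique) with $\sup\{u(p)d(q_u,p)\mid p\in P\}=r_u$. For $u\equiv1$ the baryradius and barycenter are called the circumradius $r_1$ and circumcenter $q_1$ of $P$. *)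

(* Defs.v *)
From HB Require Import structures.
From mathcomp Require Import all_boot all_order all_algebra.
From mathcomp Require Import all_classical all_reals all_analysis.

Set Implicit Arguments.
Unset Strict Implicit.
Unset Printing Implicit Defensive.
Import Order.TTheory GRing.Theory Num.Theory.
Import numFieldNormedType.Exports.
Local Open Scope classical_set_scope.
Local Open Scope ring_scope.

(* A type with a distance function; no metric axiom is imposed, so that the
   model surfaces can be given by their explicit distance formulas. *)
Record distSpace (R : realType) : Type := DistSpace {
  dpoint :> Type;
  ddist : dpoint -> dpoint -> R }.

Definition metric_dist (R : realType) (X : metricType R) : distSpace R :=
  DistSpace (@mdist R X).

Definition scale_dist (R : realType) (a : R) (S : distSpace R) : distSpace R :=
  @DistSpace R S (fun x y => a * ddist x y).

Definition edot (R : realType) (n : nat) (v w : 'rV[R]_n) : R :=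
  \sum_(i < n) v 0 i * w 0 i.

Definition lorentz (R : realType) (v w : 'rV[R]_3) : R :=
  v 0 1 * w 0 1 + v 0 2 * w 0 2 - v 0 0 * w 0 0.

Definition arcosh (R : realType) (x : R) : R :=
  ln (x + Num.sqrt (x ^+ 2 - 1)).

Definition euclidean_plane (R : realType) : distSpace R :=
  @DistSpace R 'rV[R]_2 (fun v w => Num.sqrt (edot (v - w) (v - w))).

(* The unit sphere with its angular distance. *)
Definition sphere2 (R : realType) : distSpace R :=
  @DistSpace R {v : 'rV[R]_3 | edot v v == 1}
    (fun v w => acos (edot (val v) (val w))).

(* The hyperboloid model: cosh (ddist v w) = - lorentz v w. *)
Definition hyperbolic_plane (R : realType) : distSpace R :=
  @DistSpace R {v : 'rV[R]_3 | (lorentz v v == -1) && (0 < v 0 0)}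
    (fun v w => arcosh (- lorentz (val v) (val w))).

Definition model_surface (R : realType) (k : R) : distSpace R :=
  if 0 < k then scale_dist (Num.sqrt k)^-1 (sphere2 R)
  else if k < 0 then scale_dist (Num.sqrt (- k))^-1 (hyperbolic_plane R)
  else euclidean_plane R.

Definition model_diam (R : realType) (k : R) : \bar R :=
  if 0 < k then (pi / Num.sqrt k)%:E else +oo%E.

(* c restricted to [0, d(x, y)] is a geodesic from x to y, parametrized by arc
   length; the values of c elsewhere are irrelevant. *)
Definition geodesic (R : realType) (S : distSpace R) (x y : S) (c : R -> S) :
    Prop :=
  [/\ c 0 = x, c (ddist x y) = y &
      forall s t, 0 <= s <= ddist x y -> 0 <= t <= ddist x y ->
        ddist (c s) (c t) = `|s - t|].

Definition geodesic_space (R : realType) (S : distSpace R) : Prop :=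
  forall x y : S, exists c : R -> S, geodesic x y c.

Definition side_length (R : realType) (S : distSpace R) (v : 'I_3 -> S)
    (i : 'I_3) : R :=
  ddist (v i) (v (ordS i)).

Definition perimeter (R : realType) (S : distSpace R) (v : 'I_3 -> S) : R :=
  \sum_(i < 3) side_length v i.

(* Vertices v 0, v 1, v 2; the side c i joins v i to the cyclically next vertex.
   The triangle is the union of its sides, i.e. the points c i s with
   0 <= s <= side_length v i. *)
Definition geodesic_triangle (R : realType) (S : distSpace R) (v : 'I_3 -> S)
    (c : 'I_3 -> R -> S) : Prop :=
  forall i, geodesic (v i) (v (ordS i)) (c i).

Definition comparison_triangle (R : realType) (S M : distSpace R)
    (v : 'I_3 -> S) (v' : 'I_3 -> M) (c' : 'I_3 -> R -> M) : Prop :=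
  geodesic_triangle v' c' /\ forall i, side_length v' i = side_length v i.

(* Sides being parametrized by arc length, the comparison point of c i s is
   c' i s. *)
Definition CAT (R : realType) (k : R) (X : metricType R) : Prop :=
  geodesic_space (metric_dist X) /\
  forall (v : 'I_3 -> metric_dist X) (c : 'I_3 -> R -> metric_dist X),
    geodesic_triangle v c ->
    ((perimeter v)%:E < 2%:E * model_diam k)%E ->
    exists (v' : 'I_3 -> model_surface k) (c' : 'I_3 -> R -> model_surface k),
      comparison_triangle v v' c' /\
      forall (i j : 'I_3) (s t : R),
        0 <= s <= side_length v i -> 0 <= t <= side_length v j ->
        ddist (c i s) (c j t) <= ddist (c' i s) (c' j t).

(* The library's completeness axiom, stated as a predicate because the bundled
   complete types are pointed. *)
Definition complete_space (R : realType) (X : metricType R) : Prop :=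
  forall F : set_system X, ProperFilter F -> cauchy F ->
    exists x : X, F --> x.

Definition bounded_subset (R : realType) (X : metricType R) (P : set X) : Prop :=
  exists M : R, forall p q, P p -> P q -> mdist p q <= M.

Definition diameter (R : realType) (X : metricType R) (P : set X) : \bar R :=
  ereal_sup [set (mdist pq.1 pq.2)%:E | pq in P `*` P].

(* Not the library's closed_ball, which is the closure of the open ball and is
   empty for r = 0. *)
Definition metric_closed_ball (R : realType) (X : metricType R) (x : X) (r : R) :
    set X :=
  [set y | mdist x y <= r].

(* Real-valued sup and inf: for P nonempty and bounded, and u nonnegative and
   bounded on P, both are taken over nonempty sets bounded on the relevant
   side. Only the values of u on P matter. *)
Definition weighted_radius (R : realType) (X : metricType R) (P : set X)
    (u : X -> R) (x : X) : R :=
  sup [set u p * mdist x p | p in P].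

Definition baryradius (R : realType) (X : metricType R) (P : set X)
    (u : X -> R) : R :=
  inf [set weighted_radius P u x | x in [set: X]].

Definition is_barycenter (R : realType) (X : metricType R) (P : set X)
    (u : X -> R) (q : X) : Prop :=
  weighted_radius P u q = baryradius P u.

Definition circumradius (R : realType) (X : metricType R) (P : set X) : R :=
  baryradius P (fun=> 1).

Definition is_circumcenter (R : realType) (X : metricType R) (P : set X)
    (q : X) : Prop :=
  is_barycenter P (fun=> 1) q.

(* Main.v *)
Require Import Defs.
From HB Require Import structures.
From mathcomp Require Import all_boot all_order all_algebra.
From mathcomp Require Import all_classical all_reals all_analysis.
From mathcomp Require Import ring lra.
Set Implicit Arguments.
Unset Strict Implicit.
Unset Printing Implicit Defensive.
Import Order.TTheory GRing.Theory Num.Theory.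
Import numFieldNormedType.Exports.
Local Open Scope classical_set_scope.
Local Open Scope ring_scope.

(** Suppose that the barycenter [q] lay outside the ball of radius [r] around
    [x]. Let [q'] be the point where the geodesic from [x] to [q] leaves that
    ball. Then [q'] is closer than [q] to every point of the ball that is not
    too far from [q], and by an amount [e > 0] that does not depend on the
    point ([CAT_contraction]). If [B] bounds the distances from [q] to [P], the
    inequality [d(q', p) <= d(q, p) - e] gives
    [d(q', p) <= (1 - e / B) d(q, p)], a multiplicative gain, which the weights
    [u p] respect even when they accumulate at 0. Hence the weighted radius at
    [q'] is strictly smaller than the one at [q], which contradicts the
    minimality of [q] ([barycenter_in_ball]).

    The uniform gain is a statement about the model surfaces
    ([model_contraction]). On a segment from [a] to [b] of length [s + t], the
    distance from [p] to the point [m] at distance [s] from [a] is determined by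
    the distances from [p] to [a] and [b], through Stewart's relation: an affine
    relation between the cosines (sphere), the hyperbolic cosines (hyperbolic
    plane) or the squares (Euclidean plane) of the three distances. It follows
    from the vector form of the segment: [m] is an explicit linear combination
    of [a] and [b]. This avoids angles altogether.

    For [k > 0] the comparison needs [q] to be at distance less than [D_k / 2]
    from all of [P], so that, as [r < D_k / 2] too, the triangles [x], [q], [p]
    have perimeter less than [2 D_k]. This is where the bound on the diameter
    is used: moving the centre to a point of [P] shows that [q] is within
    [D_k / 4] of some point of [P] ([barycenter_near]), hence within [D_k / 2]
    of every point. *)

(** * The Euclidean inner product *)

Lemma edotC (R : realType) n (v w : 'rV[R]_n) : edot v w = edot w v.
Proof. by apply: eq_bigr => i _; rewrite mulrC. Qed.

Lemma edotDl (R : realType) n (v1 v2 w : 'rV[R]_n) :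
  edot (v1 + v2) w = edot v1 w + edot v2 w.
Proof. by rewrite -big_split; apply: eq_bigr => i _; rewrite mxE mulrDl. Qed.

Lemma edotZl (R : realType) n (a : R) (v w : 'rV[R]_n) :
  edot (a *: v) w = a * edot v w.
Proof. by rewrite mulr_sumr; apply: eq_bigr => i _; rewrite mxE mulrA. Qed.

Lemma edotNl (R : realType) n (v w : 'rV[R]_n) : edot (- v) w = - edot v w.
Proof. by rewrite -scaleN1r edotZl mulN1r. Qed.

Lemma edotDr (R : realType) n (v w1 w2 : 'rV[R]_n) :
  edot v (w1 + w2) = edot v w1 + edot v w2.
Proof. by rewrite edotC edotDl !(edotC v). Qed.

Lemma edotZr (R : realType) n (a : R) (v w : 'rV[R]_n) :
  edot v (a *: w) = a * edot v w.
Proof. by rewrite edotC edotZl edotC. Qed.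

Lemma edotNr (R : realType) n (v w : 'rV[R]_n) : edot v (- w) = - edot v w.
Proof. by rewrite edotC edotNl edotC. Qed.

Definition edotE := (edotDl, edotDr, edotNl, edotNr, edotZl, edotZr).

Lemma edot_ge0 (R : realType) n (v : 'rV[R]_n) : 0 <= edot v v.
Proof. by apply: sumr_ge0 => i _; rewrite -expr2 sqr_ge0. Qed.

Lemma edot_eq0 (R : realType) n (v : 'rV[R]_n) : edot v v = 0 -> v = 0.
Proof.
move=> v0; apply/rowP => i; rewrite mxE; apply/eqP.
move: v0 => /psumr_eq0P vi0.
rewrite -(orbb (v 0 i == 0)) -mulf_eq0 vi0// => j _.
by rewrite -expr2 sqr_ge0.
Qed.

Lemma edot_unit (R : realType) n (v w : 'rV[R]_n) :
  edot v v = 1 -> edot w w = 1 -> -1 <= edot v w <= 1.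
Proof.
move=> v1 w1; have := edot_ge0 (v + w); have := edot_ge0 (v - w).
rewrite !edotE (edotC w v) v1 w1 => h1 h2.
by apply/andP; split; lra.
Qed.

(** * Stewart's relation in the three model geometries *)

(** The Gram matrix of [a], [m], [b] is singular: the combination of them that
    has to vanish has norm 0. *)
Lemma spherical_segment (R : realType) n (a m b : 'rV[R]_n) (s t : R) :
  edot a a = 1 -> edot m m = 1 -> edot b b = 1 ->
  edot a m = cos s -> edot m b = cos t -> edot a b = cos (s + t) ->
  sin (s + t) *: m = sin t *: a + sin s *: b.
Proof.
move=> aa mm bb am mb ab; apply/eqP; rewrite -subr_eq0; apply/eqP/edot_eq0.
rewrite opprD !edotE (edotC m a) (edotC b m) (edotC b a) aa mm bb am mb ab.
rewrite sinD cosD.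
have hs : cos s ^+ 2 = 1 - sin s ^+ 2 by rewrite -(cos2Dsin2 s) addrK.
have ht : cos t ^+ 2 = 1 - sin t ^+ 2 by rewrite -(cos2Dsin2 t) addrK.
ring: hs ht.
Qed.

Lemma sphere2_edot_itv (R : realType) (v w : sphere2 R) :
  -1 <= edot (val v) (val w) <= 1.
Proof. by apply: edot_unit; apply/eqP; [exact: (valP v)|exact: (valP w)]. Qed.

Lemma sphere2_stewart (R : realType) (a m b p : sphere2 R) (s t : R) :
  ddist a m = s -> ddist m b = t -> ddist a b = s + t ->
  sin (s + t) * cos (ddist m p) =
    sin t * cos (ddist p a) + sin s * cos (ddist b p).
Proof.
have unit (v : sphere2 R) : edot (val v) (val v) = 1 by apply/eqP/(valP v).
have cosd (v w : sphere2 R) : cos (ddist v w) = edot (val v) (val w).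
  by apply: acosK; rewrite in_itv/=; exact: sphere2_edot_itv.
move=> /(congr1 cos); rewrite cosd => am /(congr1 cos); rewrite cosd => mb.
move=> /(congr1 cos); rewrite cosd => ab; rewrite !cosd.
have := spherical_segment (unit a) (unit m) (unit b) am mb ab.
move=> /(congr1 (fun v => edot v (val p))).
by rewrite !edotE (edotC _ (val p)) => ->; rewrite (edotC (val a)).
Qed.

Definition cosh (R : realType) (x : R) : R := (expR x + expR (- x)) / 2.
Definition sinh (R : realType) (x : R) : R := (expR x - expR (- x)) / 2.

Lemma cosh2 (R : realType) (x : R) : cosh x ^+ 2 = 1 + sinh x ^+ 2.
Proof.
rewrite /cosh /sinh expRN; have := expR_gt0 x; move: (expR x) => y y0.
by field; rewrite gt_eqF.
Qed.

Lemma coshD (R : realType) (x y : R) :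
  cosh (x + y) = cosh x * cosh y + sinh x * sinh y.
Proof. by rewrite /cosh /sinh opprD !expRD; field. Qed.

Lemma sinhD (R : realType) (x y : R) :
  sinh (x + y) = sinh x * cosh y + cosh x * sinh y.
Proof. by rewrite /cosh /sinh opprD !expRD; field. Qed.

Lemma sinh_ge0 (R : realType) (x : R) : 0 <= x -> 0 <= sinh x.
Proof. by move=> x0; rewrite divr_ge0// subr_ge0 ler_expR; lra. Qed.

Lemma sinh_gt0 (R : realType) (x : R) : 0 < x -> 0 < sinh x.
Proof. by move=> x0; rewrite divr_gt0// subr_gt0 ltr_expR; lra. Qed.

Lemma cosh_gt0 (R : realType) (x : R) : 0 < cosh x.
Proof. by rewrite divr_gt0// addr_gt0// expR_gt0. Qed.

(** The graph of [cosh] lies above its tangent at [x]; here both exponentials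
    are bounded below by [1 + z <= expR z]. *)
Lemma cosh_diff (R : realType) (x y : R) :
  cosh x - cosh y <= sinh x * (x - y).
Proof.
have h1 := expR_ge1Dx (y - x); have h2 := expR_ge1Dx (x - y).
have e1 : expR y = expR x * expR (y - x) by rewrite -expRD addrC subrK.
have e2 : expR (- y) = expR (- x) * expR (x - y).
  by rewrite -expRD; congr expR; ring.
rewrite /cosh /sinh e1 e2.
have := expR_gt0 x; have := expR_gt0 (- x).
by move: (expR x) (expR (- x)) (expR _) (expR _) h1 h2 => A B C D *; nra.
Qed.

Lemma cosh_gt1 (R : realType) (x : R) : 0 < x -> 1 < cosh x.
Proof.
move=> x0; have := sinh_gt0 x0; have := cosh2 x; have := cosh_gt0 x; nra.
Qed.

Lemma cosh_homo (R : realType) (x y : R) : 0 <= x -> x <= y -> cosh x <= cosh y.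
Proof.
by move=> x0 xy; rewrite -subr_le0 (le_trans (cosh_diff _ _))//
  mulr_ge0_le0 ?sinh_ge0 ?subr_le0.
Qed.

Lemma cosh_arcosh (R : realType) (x : R) : 1 <= x -> cosh (arcosh x) = x.
Proof.
move=> x1; have h : 0 <= x ^+ 2 - 1 by rewrite subr_ge0 expr_ge1//; lra.
have := sqr_sqrtr h; have := sqrtr_ge0 (x ^+ 2 - 1).
rewrite /cosh /arcosh; move: (Num.sqrt _) => z z0 zE.
have y0 : 0 < x + z by lra.
rewrite expRN lnK//.
have -> : (x + z)^-1 = x - z.
  by apply: (mulfI (lt0r_neq0 y0)); rewrite mulfV ?gt_eqF//; lra.
by lra.
Qed.

Lemma lorentzC (R : realType) (v w : 'rV[R]_3) : lorentz v w = lorentz w v.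
Proof. by rewrite /lorentz; ring. Qed.

Lemma lorentzDl (R : realType) (v1 v2 w : 'rV[R]_3) :
  lorentz (v1 + v2) w = lorentz v1 w + lorentz v2 w.
Proof. by rewrite /lorentz !mxE; ring. Qed.

Lemma lorentzZl (R : realType) (a : R) (v w : 'rV[R]_3) :
  lorentz (a *: v) w = a * lorentz v w.
Proof. by rewrite /lorentz !mxE; ring. Qed.

Lemma lorentzNl (R : realType) (v w : 'rV[R]_3) :
  lorentz (- v) w = - lorentz v w.
Proof. by rewrite /lorentz !mxE; ring. Qed.

Lemma lorentzDr (R : realType) (v w1 w2 : 'rV[R]_3) :
  lorentz v (w1 + w2) = lorentz v w1 + lorentz v w2.
Proof. by rewrite lorentzC lorentzDl !(lorentzC v). Qed.

Lemma lorentzZr (R : realType) (a : R) (v w : 'rV[R]_3) :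
  lorentz v (a *: w) = a * lorentz v w.
Proof. by rewrite lorentzC lorentzZl lorentzC. Qed.

Lemma lorentzNr (R : realType) (v w : 'rV[R]_3) :
  lorentz v (- w) = - lorentz v w.
Proof. by rewrite lorentzC lorentzNl lorentzC. Qed.

Definition lorentzE :=
  (lorentzDl, lorentzDr, lorentzNl, lorentzNr, lorentzZl, lorentzZr).

(** By Cauchy-Schwarz for the spacelike coordinates, a null vector orthogonal
    to a timelike one has zero time coordinate. *)
Lemma lorentz_eq0 (R : realType) (w m : 'rV[R]_3) :
  lorentz m m = -1 -> lorentz w w = 0 -> lorentz w m = 0 -> w = 0.
Proof.
rewrite /lorentz => mm ww wm.
have w0 : w 0 0 = 0.
  apply/eqP; rewrite -sqrf_eq0 eq_le sqr_ge0 andbT.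
  have := sqr_ge0 (w 0 1 * m 0 2 - w 0 2 * m 0 1).
  have e : (w 0 0 * m 0 0) ^+ 2 = (w 0 1 * m 0 1 + w 0 2 * m 0 2) ^+ 2.
    by congr (_ ^+ 2); lra.
  have m0 : m 0 0 ^+ 2 = 1 + m 0 1 ^+ 2 + m 0 2 ^+ 2 by lra.
  have w00 : w 0 0 ^+ 2 = w 0 1 ^+ 2 + w 0 2 ^+ 2 by lra.
  by move: e; rewrite exprMn m0 {1}w00; lra.
have w1 : w 0 1 = 0.
  by apply/eqP; rewrite -sqrf_eq0 eq_le sqr_ge0 andbT; move: ww; rewrite w0; nra.
have w2 : w 0 2 = 0.
  by apply/eqP; rewrite -sqrf_eq0 eq_le sqr_ge0 andbT; move: ww; rewrite w0; nra.
apply/rowP => i; rewrite mxE.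
have : i \in [:: 0; 1; 2 : 'I_3] by case: i => [[|[|[|]]]].
by rewrite !inE => /or3P[] /eqP ->.
Qed.

(** The reverse Cauchy-Schwarz inequality on the upper sheet, which makes the
    hyperbolic distance well defined. *)
Lemma hyperboloid_lorentz_le (R : realType) (v w : 'rV[R]_3) :
  lorentz v v = -1 -> 0 < v 0 0 -> lorentz w w = -1 -> 0 < w 0 0 ->
  1 <= - lorentz v w.
Proof.
rewrite /lorentz; move: (v 0 0) (v 0 1) (v 0 2) (w 0 0) (w 0 1) (w 0 2).
move=> a b c d e f vv a0 ww d0.
have a1 : 1 <= a by nra.
have d1 : 1 <= d by nra.
have ad : 1 <= a * d by nra.
suff : b * e + c * f <= a * d - 1 by lra.
apply: (le_trans (ler_norm _)); rewrite -(@ler_pXn2r _ 2)// ?nnegrE//;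
  last by lra.
rewrite real_normK ?num_real//.
have := sqr_ge0 (b * f - c * e); have := sqr_ge0 (a - d).
have hb : b ^+ 2 + c ^+ 2 = a ^+ 2 - 1 by lra.
have he : e ^+ 2 + f ^+ 2 = d ^+ 2 - 1 by lra.
have : (b ^+ 2 + c ^+ 2) * (e ^+ 2 + f ^+ 2) = (a ^+ 2 - 1) * (d ^+ 2 - 1).
  by rewrite hb he.
by lra.
Qed.

(** Same argument as on the sphere; the Lorentz form being indefinite,
    orthogonality of the combination to [m] is checked too. *)
Lemma hyperbolic_segment (R : realType) (a m b : 'rV[R]_3) (s t : R) :
  lorentz a a = -1 -> lorentz m m = -1 -> lorentz b b = -1 ->
  - lorentz a m = cosh s -> - lorentz m b = cosh t ->
  - lorentz a b = cosh (s + t) ->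
  sinh (s + t) *: m = sinh t *: a + sinh s *: b.
Proof.
move=> aa mm bb /(canRL (@opprK _)) am /(canRL (@opprK _)) mb.
move=> /(canRL (@opprK _)) ab; apply/eqP; rewrite -subr_eq0; apply/eqP.
apply: (lorentz_eq0 mm).
  rewrite opprD !lorentzE (lorentzC m a) (lorentzC b m) (lorentzC b a).
  rewrite aa mm bb am mb ab sinhD coshD.
  have hs := cosh2 s; have ht := cosh2 t.
  ring: hs ht.
rewrite opprD !lorentzE (lorentzC b m) mm am mb sinhD; ring.
Qed.

Lemma hyperbolic_plane_stewart (R : realType) (a m b p : hyperbolic_plane R)
    (s t : R) :
  ddist a m = s -> ddist m b = t -> ddist a b = s + t ->
  sinh (s + t) * cosh (ddist m p) =
    sinh t * cosh (ddist p a) + sinh s * cosh (ddist b p).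
Proof.
have unit (v : hyperbolic_plane R) : lorentz (val v) (val v) = -1.
  by have /andP[/eqP] := valP v.
have pos (v : hyperbolic_plane R) : 0 < val v 0 0 by have /andP[] := valP v.
have coshd (v w : hyperbolic_plane R) :
    cosh (ddist v w) = - lorentz (val v) (val w).
  by rewrite cosh_arcosh// hyperboloid_lorentz_le.
move=> /(congr1 (@cosh R)); rewrite coshd => am.
move=> /(congr1 (@cosh R)); rewrite coshd => mb.
move=> /(congr1 (@cosh R)); rewrite coshd => ab; rewrite !coshd.
have := hyperbolic_segment (unit a) (unit m) (unit b) am mb ab.
move=> /(congr1 (fun v => lorentz v (val p))); rewrite !lorentzE => h.
by rewrite (lorentzC (val p)) !mulrN h; ring.
Qed.

(** With [A = a - m] and [B = b - m], the three lengths force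
    [edot A B = - (s * t)], so that [t *: A + s *: B] has norm 0. *)
Lemma euclidean_plane_stewart (R : realType) (a m b p : euclidean_plane R)
    (s t : R) :
  ddist a m = s -> ddist m b = t -> ddist a b = s + t ->
  (s + t) * (ddist m p ^+ 2 + s * t) =
    t * ddist p a ^+ 2 + s * ddist b p ^+ 2.
Proof.
have sqd (v w : euclidean_plane R) : ddist v w ^+ 2 = edot (v - w) (v - w).
  by rewrite sqr_sqrtr ?edot_ge0.
move=> /(congr1 (fun x => x ^+ 2)); rewrite sqd => am.
move=> /(congr1 (fun x => x ^+ 2)); rewrite sqd => mb.
move=> /(congr1 (fun x => x ^+ 2)); rewrite sqd => ab; rewrite !sqd.
have -> : p - a = (p - m) - (a - m) by rewrite opprB addrA subrK.
have -> : b - p = (b - m) - (p - m) by rewrite opprB addrA subrK.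
have abE : a - b = (a - m) - (b - m) by rewrite opprB addrA subrK.
move: am mb ab; rewrite abE -(opprB p m) -(opprB b m).
move: (a - m) (b - m) (p - m) => A B P; rewrite !edotE !opprK (edotC B A).
rewrite (edotC P A) (edotC P B) => AA BB AB.
have {}AB : edot A B = - (s * t) by lra.
have /edot_eq0/(congr1 (fun v => edot v P)) :
    edot (t *: A + s *: B) (t *: A + s *: B) = 0.
  by rewrite !edotE (edotC B A) AA BB AB; ring.
have -> : edot 0 P = 0 by rewrite -[0 in LHS](scale0r P) edotZl mul0r.
by rewrite !edotE AA BB => h; lra.
Qed.

(** * Moving towards a smaller ball *)

Lemma cos_anti (R : realType) (x y : R) :
  0 <= x -> x <= y -> y <= pi -> cos y <= cos x.
Proof.
move=> x0 xy ypi; rewrite leNgt ltr_cos -?leNgt// in_itv/=.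
  by rewrite ypi (le_trans x0).
by rewrite x0 (le_trans xy).
Qed.

Lemma cos_diff (R : realType) (x y : R) : x <= y -> cos x - cos y <= y - x.
Proof.
move=> xy; have [|z _ h] := @MVT_segment _ cos (- sin) _ _ xy.
  exact/continuous_subspaceT/continuous_cos.
rewrite -opprB h /= -mulNr opprK ler_piMl ?subr_ge0// sin_le1//.
Qed.

(** Since
    [sin L = sin r cos (L - r) + cos r sin (L - r)], bounding [cos rho] below
    by [cos r] in Stewart's relation leaves
    [sin L (cos f - cos beta) >= sin r cos beta (1 - cos (L - r))
       + sin (L - r) cos r (1 - cos beta)],
    where [cos beta >= 0] makes the first term nonnegative, and [beta >= L - r]
    keeps the last one away from 0. *)
Lemma spherical_contraction (R : realType) (r B L : R) :
  0 <= r -> r < L -> r < pi / 2 -> B < pi / 2 -> L < pi ->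
  exists2 e : R, 0 < e & forall rho beta f : R,
    0 <= rho <= r -> beta <= B -> L <= rho + beta -> 0 <= f <= pi ->
    sin L * cos f = sin (L - r) * cos rho + sin r * cos beta ->
    f + e <= beta.
Proof.
move=> r0 rL rpi Bpi Lpi; have pi0 : 0 < pi :> R by exact: pi_gt0.
have sL : 0 < sin L by rewrite sin_gt0_pi//; lra.
have sLr : 0 < sin (L - r) by rewrite sin_gt0_pi//; lra.
have cr : 0 < cos r by rewrite cos_gt0_pihalf//; lra.
have sr : 0 <= sin r by rewrite sin_ge0_pi//; lra.
have cLr : cos (L - r) < 1.
  by rewrite -cos0 ltr_cos ?in_itv/= ?subr_gt0//; lra.
have sLE : sin L = sin r * cos (L - r) + cos r * sin (L - r).
  by rewrite -sinD addrC subrK.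
pose e := sin (L - r) * cos r * (1 - cos (L - r)) / sin L.
have e0 : 0 < e by rewrite divr_gt0 ?mulr_gt0 ?subr_gt0.
exists e => // rho beta f /andP[rho0 rhor] betaB Lrb /andP[f0 fpi] stewart.
have cb : 0 <= cos beta by rewrite cos_ge0_pihalf//; lra.
have cbL : cos beta <= cos (L - r) by rewrite cos_anti//; lra.
have crho : cos r <= cos rho by rewrite cos_anti//; lra.
have gain : e <= cos f - cos beta.
  rewrite ler_pdivrMr// mulrBl ![_ * sin L]mulrC stewart sLE.
  have h1 : 0 <= sin (L - r) * (cos rho - cos r).
    by rewrite mulr_ge0 ?subr_ge0 ?(ltW sLr).
  have h2 : 0 <= sin r * cos beta * (1 - cos (L - r)).
    by rewrite !mulr_ge0 ?subr_ge0 ?(ltW cLr).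
  have h3 : 0 <= sin (L - r) * cos r * (cos (L - r) - cos beta).
    by rewrite !mulr_ge0 ?subr_ge0 ?(ltW sLr) ?(ltW cr).
  by lra.
have [fb|/ltW bf] := leP f beta; first by have := cos_diff fb; lra.
have : cos f <= cos beta by rewrite cos_anti//; lra.
by lra.
Qed.

(** As on the sphere, but [cosh] is not Lipschitz: the bound [B] on the
    distance to [b] controls its slope when the gain on [cosh] is turned into a
    gain on the distance. *)
Lemma hyperbolic_contraction (R : realType) (r B L : R) :
  0 <= r -> r < L ->
  exists2 e : R, 0 < e & forall rho beta f : R,
    0 <= rho <= r -> beta <= B -> L <= rho + beta ->
    sinh L * cosh f = sinh (L - r) * cosh rho + sinh r * cosh beta ->
    f + e <= beta.
Proof.
move=> r0 rL.
have sL : 0 < sinh L by rewrite sinh_gt0//; lra.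
have sLr : 0 < sinh (L - r) by rewrite sinh_gt0//; lra.
have cr : 0 < cosh r by exact: cosh_gt0.
have sr : 0 <= sinh r by exact: sinh_ge0.
have cLr : 1 < cosh (L - r) by rewrite cosh_gt1//; lra.
have sLE : sinh L = sinh r * cosh (L - r) + cosh r * sinh (L - r).
  by rewrite -sinhD addrC subrK.
pose g := sinh (L - r) * cosh r * (cosh (L - r) - 1) / sinh L.
have g0 : 0 < g by rewrite divr_gt0// mulr_gt0 ?subr_gt0// mulr_gt0.
exists (g / expR B); first by rewrite divr_gt0 ?expR_gt0.
move=> rho beta f /andP[rho0 rhor] betaB Lrb stewart.
have cb : 0 < cosh beta by exact: cosh_gt0.
have cbL : cosh (L - r) <= cosh beta by rewrite cosh_homo//; lra.
have crho : cosh rho <= cosh r by rewrite cosh_homo//; lra.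
have gain : g <= cosh beta - cosh f.
  rewrite ler_pdivrMr// mulrBl ![_ * sinh L]mulrC stewart sLE.
  have h1 : 0 <= sinh (L - r) * (cosh r - cosh rho).
    by rewrite mulr_ge0 ?subr_ge0 ?(ltW sLr).
  have h2 : 0 <= sinh r * cosh beta * (cosh (L - r) - 1).
    by rewrite mulr_ge0 ?subr_ge0 ?(ltW cLr)// mulr_ge0// ltW.
  have h3 : 0 <= sinh (L - r) * cosh r * (cosh beta - cosh (L - r)).
    by rewrite mulr_ge0 ?subr_ge0// mulr_ge0// ltW.
  by lra.
have sb : 0 < sinh beta by rewrite sinh_gt0//; lra.
have sbB : sinh beta <= expR B.
  rewrite ler_pdivrMr//; have : expR beta <= expR B by rewrite ler_expR.
  by have := expR_gt0 (- beta); have := expR_gt0 B; lra.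
have h := le_trans gain (cosh_diff beta f).
have bf : 0 < beta - f by rewrite -(pmulr_rgt0 _ sb); lra.
rewrite -lerBrDl ler_pdivrMr ?expR_gt0// (le_trans h)//.
by rewrite mulrC ler_pM2l.
Qed.

(** Stewart's relation gives
    [L (beta ^ 2 - f ^ 2) >= (L - r) (beta ^ 2 - r ^ 2 + r L)
       >= (L - r) ^ 3], and [beta + f <= 2 B]. *)
Lemma euclidean_contraction (R : realType) (r B L : R) :
  0 <= r -> r < L ->
  exists2 e : R, 0 < e & forall rho beta f : R,
    0 <= rho <= r -> beta <= B -> L <= rho + beta -> 0 <= f ->
    L * (f ^+ 2 + r * (L - r)) = (L - r) * rho ^+ 2 + r * beta ^+ 2 ->
    f + e <= beta.
Proof.
move=> r0 rL; have L0 : 0 < L by lra.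
have [BLr|BLr] := ltP B (L - r).
  (* No [beta] satisfies the hypotheses. *)
  by exists 1 => // rho beta f /andP[_ ? ? ?]; lra.
have B0 : 0 < B by lra.
pose g := (L - r) ^+ 3 / L.
have g0 : 0 < g by rewrite divr_gt0// exprn_gt0// subr_gt0.
exists (g / (2 * B)); first by rewrite divr_gt0//; lra.
move=> rho beta f /andP[rho0 rhor] betaB Lrb f0 stewart.
have h1 : 0 <= (L - r) * (r ^+ 2 - rho ^+ 2).
  by rewrite mulr_ge0 ?subr_ge0 ?ler_pXn2r ?nnegrE//; lra.
have h2 : 0 <= (L - r) * (beta ^+ 2 - (L - r) ^+ 2).
  by rewrite mulr_ge0 ?subr_ge0 ?ler_pXn2r ?nnegrE//; lra.
have h3 : 0 <= r * (L - r) ^+ 2 by rewrite mulr_ge0 ?sqr_ge0.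
have gain : g <= beta ^+ 2 - f ^+ 2 by rewrite ler_pdivrMr//; lra.
have fb : f < beta by rewrite -(@ltr_pXn2r _ 2)// ?nnegrE//; lra.
rewrite -lerBrDl ler_pdivrMr ?mulr_gt0// (le_trans gain)//.
by rewrite subr_sqr ler_wpM2l//; lra.
Qed.

Lemma sphere2_dist_itv (R : realType) (v w : sphere2 R) : 0 <= ddist v w <= pi.
Proof. by rewrite acos_ge0 ?acos_lepi ?sphere2_edot_itv. Qed.

(** Here [m] is the point of the segment from [a] to [b] at which that segment
    leaves the ball of radius [r] around [a]. The gain [e] is the same for all
    [p] in the ball, which is what survives passing to a supremum. *)
Lemma model_contraction (R : realType) (k r B L : R) :
  0 <= r -> r < L ->
  (0 < k -> [/\ r < pi / Num.sqrt k / 2, B < pi / Num.sqrt k / 2 &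
                L < pi / Num.sqrt k]) ->
  exists2 e : R, 0 < e & forall a b m p : model_surface k,
    ddist a b = L -> ddist a m = r -> ddist m b = L - r ->
    0 <= ddist p a <= r -> ddist b p <= B -> L <= ddist p a + ddist b p ->
    ddist m p + e <= ddist b p.
Proof.
move=> r0 rL; rewrite /model_surface; case: ltP => [k0 /(_ isT)|_ _].
  have s0 : 0 < Num.sqrt k by rewrite sqrtr_gt0.
  move: (Num.sqrt k) s0 => s s0 [rs Bs Ls].
  have scale x y : (s^-1 * x <= y) = (x <= s * y) by rewrite ler_pdivrMl.
  have scale2 x y : (x <= s^-1 * y) = (s * x <= y) by rewrite ler_pdivlMl.
  have [||||| e e0 H] := @spherical_contraction _ (s * r) (s * B) (s * L).
  - by rewrite mulr_ge0// ltW.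
  - by rewrite ltr_pM2l.
  - by rewrite mulrC -ltr_pdivlMr// mulrAC.
  - by rewrite mulrC -ltr_pdivlMr// mulrAC.
  - by rewrite mulrC -ltr_pdivlMr.
  exists (s^-1 * e); first by rewrite mulr_gt0 ?invr_gt0.
  have unscale x y : s^-1 * x = y -> x = s * y.
    by move=> <-; rewrite mulVKf ?gt_eqF.
  move=> a b m p /= /unscale ab /unscale am /unscale mb /andP[pa0 pa] bp Labp.
  rewrite -mulrDr ler_pM2l ?invr_gt0//.
  apply: (H (@ddist R (sphere2 R) p a)).
  - by have /andP[-> _] := @sphere2_dist_itv R p a; rewrite -scale.
  - by rewrite -scale.
  - by rewrite -scale2 mulrDr.
  - exact: sphere2_dist_itv.
  - have := @sphere2_stewart R a m b p _ _ am mb.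
    by rewrite -mulrDr [r + _]addrC subrK -mulrBr; apply.
case: ifP => [k0|_].
  have s0 : 0 < Num.sqrt (- k) by rewrite sqrtr_gt0 oppr_gt0.
  move: (Num.sqrt _) s0 => s s0.
  have scale x y : (s^-1 * x <= y) = (x <= s * y) by rewrite ler_pdivrMl.
  have scale2 x y : (x <= s^-1 * y) = (s * x <= y) by rewrite ler_pdivlMl.
  have unscale x y : s^-1 * x = y -> x = s * y.
    by move=> <-; rewrite mulVKf ?gt_eqF.
  have [|| e e0 H] := @hyperbolic_contraction _ (s * r) (s * B) (s * L).
  - by rewrite mulr_ge0// ltW.
  - by rewrite ltr_pM2l.
  exists (s^-1 * e); first by rewrite mulr_gt0 ?invr_gt0.
  move=> a b m p /= /unscale ab /unscale am /unscale mb /andP[pa0 pa] bp Labp.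
  rewrite -mulrDr ler_pM2l ?invr_gt0//.
  apply: (H (@ddist R (hyperbolic_plane R) p a)).
  - by rewrite -scale pa -(pmulr_rge0 _ (_ : 0 < s^-1)) ?pa0 ?invr_gt0.
  - by rewrite -scale.
  - by rewrite -scale2 mulrDr.
  - have := @hyperbolic_plane_stewart R a m b p _ _ am mb.
    by rewrite -mulrDr [r + _]addrC subrK -mulrBr; apply.
have [e e0 H] := @euclidean_contraction _ r B L r0 rL.
exists e => // a b m p ab am mb /andP[pa0 pa] bp Labp.
apply: (H (ddist p a)) => //; first by rewrite pa0.
  exact: sqrtr_ge0.
have := @euclidean_plane_stewart R a m b p _ _ am mb.
by rewrite [r + _]addrC subrK; apply.
Qed.

(** * Contraction in CAT(k) spaces *)

Lemma lte_model_diam (R : realType) (k a x : R) : 0 < a ->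
  (x%:E < a%:E * model_diam k)%E <-> (0 < k -> x < a * (pi / Num.sqrt k)).
Proof.
move=> a0; rewrite /model_diam; case: (ltP 0 k) => k0.
  by rewrite -EFinM lte_fin; split => [?|/(_ isT)].
by rewrite gt0_muley ?lte_fin// ltry.
Qed.

(** The comparison is made in the triangle [x], [q], [p], with [q'] on the side
    from [x] to [q]; its perimeter is at most twice the sum of the two sides
    at [p]. *)
Lemma CAT_contraction (R : realType) (k : R) (X : metricType R) (x q : X)
    (r B : R) :
  CAT k X -> 0 <= r -> r < mdist x q ->
  (0 < k -> [/\ r < pi / Num.sqrt k / 2, B < pi / Num.sqrt k / 2 &
                mdist x q < pi / Num.sqrt k]) ->
  exists q' : X, exists2 e : R, 0 < e & forall p : X,
    mdist x p <= r -> mdist q p <= B -> mdist q' p + e <= mdist q p.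
Proof.
move=> [geo cat] r0 rL small; set L := mdist x q in rL small.
have [c [c0 cL cdist]] := geo x q.
have [e e0 contract] := model_contraction r0 rL small.
exists (c r); exists e => // p xp qp.
have [c1 c1geo] := geo q p; have [c2 c2geo] := geo p x.
pose v := tnth [tuple x; q; p]; pose C := tnth [tuple c; c1; c2].
have tri : @geodesic_triangle R (metric_dist X) v C.
  by case=> [[|[|[|]]]] //= i3; rewrite /v /C /ordS !(tnth_nth x) /=.
have side0 : @side_length R (metric_dist X) v 0 = L by [].
have side1 : @side_length R (metric_dist X) v 1 = mdist q p by [].
have side2 : @side_length R (metric_dist X) v 2 = mdist p x by [].
have Lle : L <= mdist p x + mdist q p.
  by rewrite (metric_sym p x) (metric_sym q p) metric_triangle.
have perim : ((@perimeter R (metric_dist X) v)%:E < 2%:E * model_diam k)%E.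
  apply/lte_model_diam => // k0; have [rD BD _] := small k0.
  have -> : @perimeter R (metric_dist X) v =
      L + (mdist q p + (mdist p x + 0)).
    by rewrite /perimeter !big_ord_recl big_ord0.
  by have := metric_sym p x; lra.
have [v' [c' [[tri' side'] le']]] := cat v C tri perim.
have L' : ddist (v' 0) (v' 1) = L.
  by have := side' 0; rewrite side0 => <-; congr (ddist _ (v' _)); apply/val_inj.
have qp' : ddist (v' 1) (v' (2 : 'I_3)) = mdist q p.
  by have := side' 1; rewrite side1 => <-; congr (ddist _ (v' _)); apply/val_inj.
have px' : ddist (v' (2 : 'I_3)) (v' 0) = mdist p x.
  have := side' (2 : 'I_3); rewrite side2 => <-.
  by congr (ddist _ (v' _)); apply/val_inj.
have ord1 : ordS 0 = 1 :> 'I_3 by apply/val_inj.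
have [c'0 c'L c'dist] := tri' 0; have [c'2 _ _] := tri' (2 : 'I_3).
rewrite ord1 L' in c'L c'dist.
have am : ddist (v' 0) (c' 0 r) = r.
  by rewrite -{1}c'0 c'dist ?sub0r ?normrN ?ger0_norm ?lexx//=; lra.
have mb : ddist (c' 0 r) (v' 1) = L - r.
  rewrite -c'L c'dist; [|lra|lra].
  by rewrite distrC ger0_norm//; lra.
have q'p : mdist (c r) p <= ddist (c' 0 r) (v' (2 : 'I_3)).
  have [c20 _ _] := c2geo; rewrite -c'2 -[p in mdist _ p]c20.
  by apply: (le' 0 (2 : 'I_3)); rewrite ?side0 ?side2 ?mdist_ge0 ?lexx//; lra.
rewrite -qp'; apply: (le_trans _ (contract _ _ _ _ L' am mb _ _ _)).
- by rewrite lerD2r.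
- by rewrite px' mdist_ge0 metric_sym.
- by rewrite qp'.
- by rewrite px' qp'.
Qed.

(** * The weighted radius *)

Section WeightedRadius.
Variables (R : realType) (X : metricType R) (P : set X) (u : X -> R).
Hypotheses (P_bounded : bounded_subset P) (P_neq0 : P !=set0).
Hypotheses (u_ge0 : forall p, P p -> 0 <= u p).
Hypotheses (u_bounded : exists M : R, forall p, P p -> `|u p| <= M).

Lemma weighted_radius_ge (x p : X) :
  P p -> u p * mdist x p <= weighted_radius P u x.
Proof.
move=> Pp; apply: ub_le_sup; last by exists p.
have [M uM] := u_bounded; have [N PN] := P_bounded; have [p0 Pp0] := P_neq0.
exists (M * (mdist x p0 + N)) => _ [p1 Pp1 <-].
rewrite ler_pM ?u_ge0 ?mdist_ge0//; first by rewrite (le_trans (ler_norm _)) ?uM.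
by rewrite (le_trans (metric_triangle x p0 p1))// lerD2l PN.
Qed.

Lemma weighted_radius_le (x : X) (c : R) :
  (forall p, P p -> u p * mdist x p <= c) -> weighted_radius P u x <= c.
Proof.
move=> H; have [p0 Pp0] := P_neq0; apply: ge_sup.
  by exists (u p0 * mdist x p0), p0.
by move=> _ [p Pp <-]; exact: H.
Qed.

Lemma baryradius_le (x : X) : baryradius P u <= weighted_radius P u x.
Proof.
apply: ge_inf; last by exists x.
exists 0 => _ [y _ <-]; have [p Pp] := P_neq0.
by rewrite (le_trans _ (weighted_radius_ge y Pp))// mulr_ge0 ?u_ge0 ?mdist_ge0.
Qed.

End WeightedRadius.

(** * Barycenters *)

Lemma diameter_bound (R : realType) (k a : R) (X : metricType R) (P : set X) :
  0 < a -> P !=set0 -> bounded_subset P ->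
  (diameter P < a%:E * model_diam k)%E ->
  exists2 N : R, forall p q, P p -> P q -> mdist p q <= N &
    0 < k -> N < a * (pi / Num.sqrt k).
Proof.
move=> a0 [p0 Pp0] [M PM] Pa.
have [k0|k0] := ltP 0 k; last by exists M => // ?.
have diam p q : P p -> P q -> ((mdist p q)%:E <= diameter P)%E.
  by move=> Pp Pq; apply: ereal_sup_ubound; exists (p, q).
have dfin : diameter P \is a fin_num.
  rewrite fin_real// (lt_le_trans (ltNyr _) (diam _ _ Pp0 Pp0))/=.
  by rewrite (lt_le_trans Pa)// leey.
exists (fine (diameter P)); last first.
  by move=> _; apply: (lte_model_diam k _ a0).1 k0; rewrite fineK.
by move=> p q Pp Pq; rewrite -lee_fin fineK// diam.
Qed.

(** If all of [P] were at distance at least [D] from [q], then, with [S] the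
    supremum of [u], the weighted radius would be at least [S * D] at [q] but at
    most [S * N] at any point of [P]. *)
Lemma barycenter_near (R : realType) (X : metricType R) (P : set X) (u : X -> R)
    (N D : R) (q : X) :
  bounded_subset P -> (forall p, P p -> 0 <= u p) ->
  (exists M : R, forall p, P p -> `|u p| <= M) ->
  (exists2 p, P p & u p != 0) ->
  (forall p p', P p -> P p' -> mdist p p' <= N) -> N < D ->
  is_barycenter P u q ->
  exists2 p, P p & mdist q p < D.
Proof.
move=> Pb u0 [M uM] [p0 Pp0 up0] PN ND bar.
have Pn0 : P !=set0 by exists p0.
have ub : exists M : R, forall p, P p -> `|u p| <= M by exists M.
have N0 : 0 <= N by rewrite (le_trans _ (PN _ _ Pp0 Pp0)) ?mdist_ge0.
apply: contrapT => /forall2NP far.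
have {}far p : P p -> D <= mdist q p.
  by move=> Pp; case: (far p) => // /negP; rewrite -leNgt.
have D0 : 0 < D by lra.
have uPub : has_ubound (u @` P).
  by exists M => _ [p Pp <-]; rewrite (le_trans (ler_norm _)) ?uM.
set S := sup (u @` P).
have uS p : P p -> u p <= S by move=> Pp; apply: ub_le_sup => //; exists p.
have S0 : 0 < S by rewrite (lt_le_trans _ (uS _ Pp0))// lt0r up0 u0.
have rN : baryradius P u <= S * N.
  apply: (le_trans (baryradius_le Pb Pn0 u0 ub p0)).
  by apply: weighted_radius_le => // p Pp; rewrite ler_pM ?u0 ?mdist_ge0 ?uS ?PN.
have : S <= baryradius P u / D.
  apply: ge_sup; first by exists (u p0), p0.
  move=> _ [p Pp <-]; rewrite ler_pdivlMr// -bar.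
  apply: (le_trans _ (weighted_radius_ge Pb Pn0 u0 ub q Pp)).
  by rewrite ler_wpM2l ?u0 ?far.
by rewrite ler_pdivlMr// => /le_trans/(_ rN); rewrite ler_pM2l// leNgt ND.
Qed.

(** A factor [1 - e / B < 1] contradicts minimality because the weighted radius
    at [q] is positive: a point of nonzero weight is at distance at least [e]
    from [q]. *)
Lemma barycenter_in_ball (R : realType) (k : R) (X : metricType R) (P : set X)
    (u : X -> R) (x q : X) (r : R) :
  CAT k X -> bounded_subset P ->
  (diameter P < (4^-1)%:E * model_diam k)%E ->
  (forall p, P p -> 0 <= u p) ->
  (exists M : R, forall p, P p -> `|u p| <= M) ->
  (exists2 p, P p & u p != 0) ->
  P `<=` metric_closed_ball x r -> (r%:E < (2^-1)%:E * model_diam k)%E ->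
  is_barycenter P u q -> metric_closed_ball x r q.
Proof.
move=> XCAT Pb Pdiam u0 ub une Px rD bar.
have [p0 Pp0 up0] := une; have Pn0 : P !=set0 by exists p0.
have a4 : 0 < 4^-1 :> R by rewrite invr_gt0.
have a2 : 0 < 2^-1 :> R by rewrite invr_gt0.
have [N PN ND] := diameter_bound a4 Pn0 Pb Pdiam.
move/(lte_model_diam _ _ a2) : rD => rD.
have r0 : 0 <= r by rewrite (le_trans _ (Px _ Pp0)) ?mdist_ge0.
rewrite /metric_closed_ball/= leNgt; apply/negP => rq.
have [p1 Pp1 qp1] : exists2 p, P p &
    (0 < k -> mdist q p < 4^-1 * (pi / Num.sqrt k)).
  have [k0|_] := ltP 0 k; last by exists p0.
  have [p Pp qp] := barycenter_near Pb u0 ub une PN (ND k0) bar.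
  by exists p.
pose B := mdist q p1 + N.
have qB p : P p -> mdist q p <= B.
  by move=> Pp; rewrite (le_trans (metric_triangle q p1 p))// lerD2l PN.
have [|q' [e e0 gain]] := @CAT_contraction _ k X x q r B XCAT r0 rq.
  move=> k0; have := rD k0; have := ND k0; have := qp1 k0.
  have := metric_triangle x p1 q; rewrite (metric_sym p1 q).
  have := Px _ Pp1; rewrite /metric_closed_ball/= /B.
  by move: (mdist x p1) (mdist q p1) (mdist x q) (pi / _) => *; split; lra.
have eB p : P p -> e <= mdist q p.
  by move=> Pp; have := gain p (Px _ Pp) (qB _ Pp); have := mdist_ge0 q' p; lra.
have B0 : 0 < B by rewrite (lt_le_trans e0)// (le_trans (eB _ Pp0))// qB.
have shrink : weighted_radius P u q' <= (1 - e / B) * weighted_radius P u q.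
  have eB1 : e / B <= 1.
    by rewrite ler_pdivrMr// mul1r (le_trans (eB _ Pp0))// qB.
  apply: weighted_radius_le => // p Pp.
  apply: (@le_trans _ _ ((1 - e / B) * (u p * mdist q p))); last first.
    by rewrite ler_wpM2l ?subr_ge0// weighted_radius_ge.
  rewrite mulrCA ler_wpM2l ?u0//.
  have : e / B * mdist q p <= e.
    by rewrite mulrAC ler_pdivrMr// ler_pM2l// qB.
  by have := gain p (Px _ Pp) (qB _ Pp); lra.
have : 0 < weighted_radius P u q.
  rewrite (lt_le_trans _ (weighted_radius_ge Pb Pn0 u0 ub q Pp0))//.
  rewrite mulr_gt0//; first by rewrite lt0r up0 u0.
  exact: lt_le_trans e0 (eB _ Pp0).
have := baryradius_le Pb Pn0 u0 ub q'; rewrite -bar.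
have eB0 : 0 < e / B by rewrite divr_gt0.
by move=> h1 h2; have := mulr_gt0 eB0 h2; lra.
Qed.

Theorem proposition3 (R : realType) (k : R) (X : metricType R)
  (X_complete : complete_space X) (X_CAT : CAT k X)
  (P : set X) (P_bounded : bounded_subset P)
  (P_diam : (diameter P < (4^-1)%:E * model_diam k)%E)
  (u : X -> R) (u_ge0 : forall p, P p -> 0 <= u p)
  (u_bounded : exists M : R, forall p, P p -> `|u p| <= M)
  (u_neq0 : exists2 p, P p & u p != 0) :
  (forall (x : X) (r : R),
     P `<=` metric_closed_ball x r ->
     (r%:E < (2^-1)%:E * model_diam k)%E ->
     forall qu : X, is_barycenter P u qu -> metric_closed_ball x r qu) /\
  (forall q1 qu : X,
     is_circumcenter P q1 -> is_barycenter P u qu ->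
     metric_closed_ball q1 (circumradius P) qu).
Proof.
have [p0 Pp0 _] := u_neq0; have P_neq0 : P !=set0 by exists p0.
have one_bounded : exists M : R, forall p, P p -> `|1 : R| <= M.
  by exists 1 => p _; rewrite normr1.
have one_ge0 p : P p -> 0 <= 1 :> R by [].
split=> [x r Px rD qu bar|q1 qu bar1].
  exact: barycenter_in_ball X_CAT P_bounded P_diam u_ge0 u_bounded u_neq0 Px rD
    bar.
(* The ball around [q1] contains [P] because [q1] attains the circumradius;
   its radius is small enough, being at most the diameter. *)
move=> bar; apply: (barycenter_in_ball X_CAT P_bounded P_diam u_ge0 u_bounded
  u_neq0 _ _ bar).
  move=> p Pp; rewrite /metric_closed_ball/= /circumradius -bar1 -[leLHS]mul1r.
  exact: (weighted_radius_ge P_bounded P_neq0 one_ge0 one_bounded).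
have a4 : 0 < 4^-1 :> R by rewrite invr_gt0.
have a2 : 0 < 2^-1 :> R by rewrite invr_gt0.
have [N PN ND] := diameter_bound a4 P_neq0 P_bounded P_diam.
apply/(lte_model_diam _ _ a2) => k0.
have rN : circumradius P <= N.
  apply: (le_trans (baryradius_le P_bounded P_neq0 one_ge0 one_bounded p0)).
  by apply: weighted_radius_le => // p Pp; rewrite mul1r PN.
have := ND k0; have : 0 <= N.
  by rewrite (le_trans _ (PN _ _ Pp0 Pp0)) ?mdist_ge0.
by lra.
Qed.
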